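(* Let $I$ be a finite set of students, $C$ a finite set of schools, and $(q_c)_{c\in C}$ capacities with $q_c\in\mathbb{N}$. Let $\varphi=(\sigma,\psi)$ be a mechanism for the market $(I,C,(q_c)_{c\in C})$. If $\varphi$ satisfies strategy-proofness, RD stability, and rank monotonicity, then $\varphi$ is outcome equivalent to the student-proposing Deferred Acceptance mechanism applied to the original priorities; that is, $\varphi(P,\succ)=DA^S(P,\succ)$ for every preference profile $P\in\mathcal{P}^{|I|}$ and every profile of strict original priorities $\succ\in\Pi^{|C|}$.
   Context: Preferences. $\mathcal{P}$ is the set of strict preference relations (strict linear orders) over $C\cup\{\emptyset\}$, where $\emptyset$ denotes being unmatched. For $P_i\in\mathcal{P}$, $x\,R_i\,y$ means $x\,P_i\,y$ or $x=y$. A preference profile is $P=(P_i)_{i\in I}\in\mathcal{P}^{|I|}$, and $(P_i',P_{-i})$ is the profile in which $i$'s preference is replaced by $P'_i$. For $c\in C\cup\{\emptyset\}$, $r_{ic}(P_i)\in\mathbb{N}$ is the rank (position) of $c$ in $P_i$, the most preferred element having rank $1$. Priorities. $\Pi$ is the set of strict priority orders (strict linear orders) over $I$. A priority profile is $\succ=(\succ_c)_{c\in C}\in\Pi^{|C|}$. Matchings. $\mathcal{M}$ is the set of feasible matchings, i.e. maps $\mu:I\to C\cup\{\emptyset\}$ such that $\mu(c):=\{i\in I:\mu(i)=c\}$ satisfies $|\mu(c)|\le q_c$ for every $c\in C$. Mechanisms. A mechanism $\varphi=(\sigma,\psi)$ consists of a modification rule $\sigma:\mathcal{P}^{|I|}\times\Pi^{|C|}\to\Pi^{|C|}$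 and a matching rule $\psi:\mathcal{P}^{|I|}\times\Pi^{|C|}\to\mathcal{M}$, and its outcome is $\varphi(P,\succ)=\psi(P,\succ^* )$, where $\succ^*=\sigma(P,\succ)$ is the modified priority profile. $\varphi_i(P,\succ)$ denotes student $i$'s assignment. Stability. A matching $\mu$ is stable with respect to $(P,\succ)$ if: (individual rationality) for every $i\in I$, $\mu(i)\,P_i\,\emptyset$ or $\mu(i)=\emptyset$; (non-wastefulness) for every $i\in I$ and $c\in C$, $c\,P_i\,\mu(i)$ implies $|\mu(c)|=q_c$; and (no blocking pair) there is no $(i,c)\in I\times C$ such that $c\,P_i\,\mu(i)$ and $i\succ_c j$ for some $j\in\mu(c)$. Axioms. - Strategy-proofness: for all $i\in I$, $\succ\in\Pi^{|C|}$, $P\in\mathcal{P}^{|I|}$, $P_i'\in\mathcal{P}$: $\varphi_i(P,\succ)\,R_i\,\varphi_i((P_i',P_{-i}),\succ)$. - Rank monotonicity: for all $P\in\mathcal{P}^{|I|}$, $\succ\in\Pi^{|C|}$, $c\in C$, $i,j\in I$ with $i\succ_c j$: if $r_{ic}(P_i)\le r_{jc}(P_j)$ then $i\succ^*_c j$, where $\succ^*=\sigma(P,\succ)$. - RD stability: for all $P\in\mathcal{P}^{|I|}$ and $\succ\in\Pi^{|C|}$, $\varphi(P,\succ)$ is stable with respect to $(P,\succ^* )$, where $\succ^*=\sigma(P,\succ)$. Student-proposing DA. $DA^S(P,\succ)$ is the outcome of the standard Gale–Shapley student-proposing deferred acceptance algorithm under preferences $P$, priorities $\succ$, and capacities $(q_c)$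 (students propose only to schools preferred to $\emptyset$; schools find all students acceptable); equivalently, it is the student-optimal matching among those stable with respect to $(P,\succ)$. *)

(* Defs.v *)
From HB Require Import structures.
From mathcomp Require Import all_boot.

Set Implicit Arguments.
Unset Strict Implicit.
Unset Printing Implicit Defensive.

Section StrictOrders.
Variable T : finType.

Definition strict_linear (r : rel T) : bool :=
  [&& [forall x, ~~ r x x],
      [forall x, forall y, forall z, r x y && r y z ==> r x z]
    & [forall x, forall y, (x != y) ==> r x y || r y x]].

(* The order is stored as its graph, a finite set, so that two orders relating
   the same pairs are equal. *)
Record strict_order := StrictOrder {
  order_graph : {set T * T};
  _ : strict_linear [rel x y | (x, y) \in order_graph]
}.

HB.instance Definition _ := [isSub for order_graph].
HB.instance Definition _ := [Finite of strict_order by <:].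

Definition before (P : strict_order) : rel T :=
  [rel x y | (x, y) \in order_graph P].

Definition weakly_before (P : strict_order) : rel T :=
  [rel x y | (x == y) || before P x y].

Definition rank (P : strict_order) (x : T) : nat :=
  #|[set y | before P y x]|.+1.

End StrictOrders.

Section Market.
Variables (I C : finType) (q : C -> nat).

(* In [option C], [None] stands for being unmatched. *)
Definition preference := strict_order (option C).
Definition pref_profile := {ffun I -> preference}.
Definition prio_profile := {ffun C -> strict_order I}.

Definition replace_pref (P : pref_profile) (i : I) (Pi' : preference) :
    pref_profile :=
  [ffun j => if j == i then Pi' else P j].

Definition assigned (mu : {ffun I -> option C}) (c : C) : {set I} :=
  [set i | mu i == Some c].

Definition feasible (mu : {ffun I -> option C}) : bool :=
  [forall c, #|assigned mu c| <= q c].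

Record matching := Matching {
  assignment :> {ffun I -> option C};
  _ : feasible assignment
}.

HB.instance Definition _ := [isSub for assignment].
HB.instance Definition _ := [Finite of matching by <:].

Record mechanism := Mechanism {
  modification_rule : pref_profile -> prio_profile -> prio_profile;
  matching_rule : pref_profile -> prio_profile -> matching
}.

Definition outcome (phi : mechanism) (P : pref_profile) (s : prio_profile) :
    matching :=
  matching_rule phi P (modification_rule phi P s).

Definition individually_rational (P : pref_profile) (mu : matching) : Prop :=
  forall i : I, before (P i) (mu i) None \/ mu i = None.

Definition nonwasteful (P : pref_profile) (mu : matching) : Prop :=
  forall (i : I) (c : C),
    before (P i) (Some c) (mu i) -> #|assigned mu c| = q c.

Definition no_blocking_pair (P : pref_profile) (s : prio_profile)
    (mu : matching) : Prop :=
  ~ exists (i : I) (c : C), before (P i) (Some c) (mu i) /\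
      exists2 j : I, j \in assigned mu c & before (s c) i j.

Definition stable (P : pref_profile) (s : prio_profile) (mu : matching) :
    Prop :=
  [/\ individually_rational P mu, nonwasteful P mu & no_blocking_pair P s mu].

Definition strategy_proof (phi : mechanism) : Prop :=
  forall (i : I) (s : prio_profile) (P : pref_profile) (Pi' : preference),
    weakly_before (P i) (outcome phi P s i)
      (outcome phi (replace_pref P i Pi') s i).

Definition rank_monotonic (phi : mechanism) : Prop :=
  forall (P : pref_profile) (s : prio_profile) (c : C) (i j : I),
    before (s c) i j ->
    rank (P i) (Some c) <= rank (P j) (Some c) ->
    before (modification_rule phi P s c) i j.

Definition rd_stable (phi : mechanism) : Prop :=
  forall (P : pref_profile) (s : prio_profile),
    stable P (modification_rule phi P s) (outcome phi P s).

Section DeferredAcceptance.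
Variables (P : pref_profile) (s : prio_profile).

(* The state of the algorithm is the set [R] of pairs (i, c) such that school c
   has already rejected student i. In every round each student applies to the
   best acceptable school that has not rejected her; a student who is
   tentatively held thus applies again to the school holding her, and
   [applicants R c] consists of the held students and the new proposers. *)
Definition application (R : {set I * C}) (i : I) : option C :=
  [pick c | [&& (i, c) \notin R, before (P i) (Some c) None
    & [forall d, ((i, d) \notin R) ==>
                   weakly_before (P i) (Some c) (Some d)]]].

Definition applicants (R : {set I * C}) (c : C) : {set I} :=
  [set i | application R i == Some c].

(* School c holds its [q c] highest-priority applicants and rejects the rest. *)
Definition rejected_now (R : {set I * C}) : {set I * C} :=
  [set ic | (ic.1 \in applicants R ic.2) &&
    (q ic.2 <= #|[set j in applicants R ic.2 | before (s ic.2) j ic.1]|)].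

Definition DA_round (R : {set I * C}) : {set I * C} := R :|: rejected_now R.

(* Each round before termination rejects a new pair, so [#|{: I * C}|] rounds
   suffice; rounds after termination change nothing (see [DA_terminates]). *)
Definition DA_rejections : {set I * C} :=
  iter #|{: I * C}| DA_round set0.

Definition DA_assignment : {ffun I -> option C} :=
  [ffun i => application DA_rejections i].

Lemma DA_terminates : DA_round DA_rejections = DA_rejections.
Proof.
have fixS k : DA_round (iter k DA_round set0) = iter k DA_round set0 ->
    DA_round (iter k.+1 DA_round set0) = iter k.+1 DA_round set0.
  by move=> e; rewrite iterS !e.
suff: forall k, DA_round (iter k DA_round set0) = iter k DA_round set0 \/
    k < #|DA_round (iter k DA_round set0)|.
  by case/(_ #|{: I * C}|) => // /leq_trans/(_ (max_card _)); rewrite ltnn.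
elim=> [|k [/fixS e|lt_k]]; [|by left|].
- case: (set_0Vmem (DA_round set0)) => [e|[x xR]]; first by left.
  by right; rewrite card_gt0; apply/set0Pn; exists x.
- case: (eqVneq (DA_round (iter k.+1 DA_round set0)) (iter k.+1 DA_round set0)).
    by left.
  move=> neq; right; apply: leq_ltn_trans lt_k _.
  by apply: proper_card; rewrite properEneq eq_sym neq subsetUl.
Qed.

Lemma DA_feasible : feasible DA_assignment.
Proof.
apply/forallP => c; rewrite leqNgt; apply/negP => lt_q.
have EA : assigned DA_assignment c = applicants DA_rejections c.
  by apply/setP => i; rewrite !inE ffunE.
rewrite EA in lt_q; set A := applicants _ c in lt_q.
have /and3P[irr /forallP tr /forallP tot] : strict_linear (before (s c)).
  by case: (s c).
have [i0 i0A] : exists i, i \in A.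
  by apply/set0Pn; rewrite -card_gt0 (leq_ltn_trans _ lt_q).
pose above i := #|[set j in A | before (s c) j i]|.
have [i /= iA imax] := @arg_maxnP _ i0 (mem A) above i0A.
have {}iA : i \in A by [].
have iabove : [set j in A | before (s c) j i] = A :\ i.
  apply/setP => j; rewrite in_setD1 inE andbC.
  case jA: (j \in A); rewrite ?andbF ?andbT //.
  case: (eqVneq j i) => [->|ji] /=; first exact/negbTE/(forallP irr).
  have /forallP/(_ i)/implyP/(_ ji)/orP[//|ij] := tot j.
  have := imax j jA; rewrite /= leqNgt => /negP[]; apply: proper_card.
  apply/properP; split.
    apply/subsetP => k; rewrite !inE => /andP[-> ki] /=.
    have /forallP/(_ i)/forallP/(_ j)/implyP := tr k.
    by apply; apply/andP.
  exists i; first by rewrite inE; apply/andP; split.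
  by rewrite inE negb_and (forallP irr i) orbT.
have : (i, c) \in DA_rejections.
  rewrite -DA_terminates; apply/setUP; right; rewrite inE /= -/A iA iabove.
  by rewrite -ltnS (leq_trans lt_q) // (cardsD1 i A) iA.
move: iA; rewrite !inE /application; case: pickP => [d /and3P[iR _ _]|//].
by case/eqP => <-; rewrite (negbTE iR).
Qed.

Definition DA : matching := Matching DA_feasible.

End DeferredAcceptance.

End Market.

(* Main.v *)
Require Import Defs.
From mathcomp Require Import all_boot.

(** Fix the priorities.  Call a student narrow if she finds at most one school
   acceptable; such a school then has rank 1 for her, so rank monotonicity and
   RD stability together prevent her from blocking the outcome with respect to
   the original priorities.  Let [g] and [h] be two strategy-proof,
   individually rational and non-wasteful rules that no narrow student blocks.
   They agree, by induction on the number of students who are not narrow: if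
   such a student received a better school [c] under [g] than under [h], she
   would still get [c] under [g] when reporting [c] as her only acceptable
   school, hence also under [h] by induction, so that she could manipulate [h].
   The two matchings can therefore differ only at narrow students, and each
   school fills the seats left by the others with the narrow applicants of
   highest priority.  The theorem is the case where [g] is the mechanism and
   [h] is deferred acceptance. *)

Set Implicit Arguments.
Unset Strict Implicit.
Unset Printing Implicit Defensive.

(** * Strict linear orders on a finite type *)

Section StrictOrderFacts.
Variables (T : finType) (Q : strict_order T).
Implicit Types x y z : T.

Lemma before_linear : strict_linear (before Q).
Proof. by case: Q. Qed.

Lemma beforexx x : before Q x x = false.
Proof. by have /and3P[/forallP/(_ x)/negbTE] := before_linear. Qed.

Lemma before_trans y x z : before Q x y -> before Q y z -> before Q x z.
Proof.
have /and3P[_ /forallP/(_ x)/forallP/(_ y)/forallP/(_ z)/implyP tr _] :=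
  before_linear.
by move=> xy yz; apply: tr; rewrite xy.
Qed.

Lemma before_total x y : x != y -> before Q x y || before Q y x.
Proof.
have /and3P[_ _ /forallP/(_ x)/forallP/(_ y)/implyP] := before_linear.
exact.
Qed.

Lemma before_asym x y : before Q x y -> before Q y x = false.
Proof. by move=> xy; apply/negP => /(before_trans xy); rewrite beforexx. Qed.

Lemma weakly_beforeNgt x y : weakly_before Q x y = ~~ before Q y x.
Proof.
rewrite /weakly_before /=.
case: eqVneq => [->|/before_total]; first by rewrite beforexx.
by case xy: (before Q x y); rewrite ?(before_asym xy) //= => ->.
Qed.

Lemma weakly_beforexx x : weakly_before Q x x.
Proof. by rewrite weakly_beforeNgt beforexx. Qed.

Lemma before_weakly x y : before Q x y -> weakly_before Q x y.
Proof. by rewrite weakly_beforeNgt => /before_asym->. Qed.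

Lemma before_weak_trans y x z :
  before Q x y -> weakly_before Q y z -> before Q x z.
Proof. by move=> xy /predU1P[<-|]; last exact: before_trans. Qed.

Lemma weak_before_trans y x z :
  weakly_before Q x y -> before Q y z -> before Q x z.
Proof. by case/predU1P=> [->|]; last exact: before_trans. Qed.

Lemma before_best (A : {set T}) x0 :
  x0 \in A -> exists2 x, x \in A & {in A, forall y, weakly_before Q x y}.
Proof.
move=> x0A.
have [x /= xA xmin] := @arg_minnP _ x0 (mem A) (rank Q) x0A.
exists x => // y yA; rewrite weakly_beforeNgt; apply/negP => yx.
have := xmin y yA; rewrite leqNgt => /negP[]; rewrite ltnS.
apply/proper_card/properP; split.
  by apply/subsetP => z; rewrite !inE => /before_trans; apply.
by exists y; rewrite inE ?beforexx.
Qed.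

(** A school with [n] seats facing the applicants [A] keeps those with fewer than [n] members of [A]
    above them. If some member of [A] above [x] has at least [n] above it, the claim for it implies
    the claim for [x]; if there is none, everyone in [A] above [x] is kept. *)
Lemma card_above_unrejected (A : {set T}) (n : nat) x :
    n <= #|[set y in A | before Q y x]| ->
  n <= #|[set y in A | before Q y x &&
            (#|[set z in A | before Q z y]| < n)]|.
Proof.
pose ab x := [set y in A | before Q y x].
have [m] := ubnP #|ab x|; elim: m x => // m IHm x lt_m le_n.
have [/existsP[y /and3P[yA yx le_y]]|/existsPn none] :=
  boolP [exists y, [&& y \in A, before Q y x & n <= #|ab y|]].
  have sub z : before Q z y -> before Q z x by move/before_trans; apply.
  have /IHm/(_ le_y)/leq_trans : #|ab y| < m.
    rewrite -ltnS; apply: leq_trans lt_m; rewrite ltnS.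
    apply/proper_card/properP; split.
      by apply/subsetP => z; rewrite !inE => /andP[-> /sub].
    by exists y; rewrite inE yA ?yx ?beforexx.
  apply; apply/subset_leq_card/subsetP => z.
  by rewrite !inE => /and3P[-> /sub-> ->].
apply: leq_trans le_n _; apply/subset_leq_card/subsetP => y.
rewrite !inE => /andP[yA yx]; rewrite yA yx /= ltnNge.
by have := none y; rewrite yA yx.
Qed.

End StrictOrderFacts.

(** * Preferences with a prescribed set of acceptable schools *)

Section KeepAcceptable.
Variables (C : finType) (Q : preference C) (A : pred C).

(** The value for [None] lies between the two values for schools, so that exactly the schools in [A]
    become acceptable. *)
Definition keep_level (x : option C) : nat :=
  if x is Some c then (if A c then 0 else 2) else 1.

Definition keep_rel : rel (option C) := [rel x y |
  (keep_level x < keep_level y)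
  || (keep_level x == keep_level y) && before Q x y].

Lemma keep_linear :
  strict_linear
    [rel x y | (x, y) \in [set xy : option C * option C | keep_rel xy.1 xy.2]].
Proof.
apply/and3P; split.
- by apply/forallP => x; rewrite /= inE /keep_rel /= ltnn eqxx beforexx.
- apply/forallP => x; apply/forallP => y; apply/forallP => z.
  rewrite /= !inE /keep_rel /=; apply/implyP => /andP[].
  case: (ltngtP (keep_level x)) => //= [xy _|->].
    case: (ltngtP (keep_level y)) => //= [yz _|<- _]; last by rewrite xy.
    by rewrite (ltn_trans xy yz).
  by move=> xy; case: ltngtP => //= _; apply: before_trans.
- apply/forallP => x; apply/forallP => y; apply/implyP => xy.
  by rewrite /= !inE /keep_rel /=; case: ltngtP => //= _; apply: before_total.
Qed.

Definition keep : preference C := StrictOrder keep_linear.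

Lemma before_keep x y : before keep x y = keep_rel x y.
Proof. by rewrite /before /= inE. Qed.

Lemma before_keepSN c : before keep (Some c) None = A c.
Proof. by rewrite before_keep /keep_rel /=; case: (A c). Qed.

Lemma before_keepSS c d : A d ->
  before keep (Some c) (Some d) = A c && before Q (Some c) (Some d).
Proof. by move=> Ad; rewrite before_keep /keep_rel /= Ad; case: (A c). Qed.

End KeepAcceptable.

Section Market.
Variables (I C : finType) (q : C -> nat).
Implicit Types (P : pref_profile I C) (s : prio_profile I C).
Implicit Types (Q : preference C) (mu nu : matching I q).
Implicit Types (i j : I) (c d : C).

Lemma replace_pref_same P i Q : replace_pref P i Q i = Q.
Proof. by rewrite ffunE eqxx. Qed.

Lemma replace_pref_other P i Q j : j != i -> replace_pref P i Q j = P j.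
Proof. by rewrite ffunE => /negbTE->. Qed.

Lemma replace_prefK P i Q : replace_pref (replace_pref P i Q) i (P i) = P.
Proof. by apply/ffunP => j; rewrite !ffunE; case: eqVneq => [->|]. Qed.

Lemma replace_pref_replace P i Q Q' :
  replace_pref (replace_pref P i Q) i Q' = replace_pref P i Q'.
Proof. by apply/ffunP => j; rewrite !ffunE; case: eqVneq. Qed.

Lemma card_assigned_le mu c : #|assigned mu c| <= q c.
Proof. by case: mu => mu /= /forallP. Qed.

Lemma individually_rational_weak P mu i :
  individually_rational P mu -> weakly_before (P i) (mu i) None.
Proof. by case/(_ i) => [/before_weakly//|->]; apply: weakly_beforexx. Qed.

(** * Stability and student-optimality of deferred acceptance *)

Section DAProperties.
Variables (P : pref_profile I C) (s : prio_profile I C).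
Implicit Type R : {set I * C}.

Lemma application_Some R i c : application P R i = Some c ->
  (i, c) \notin R /\ before (P i) (Some c) None.
Proof. by rewrite /application; case: pickP => // d /and3P[? ? _] [<-]. Qed.

Lemma application_best R i (x : option C) :
    (forall d, x = Some d -> (i, d) \notin R) ->
  weakly_before (P i) (application P R i) x.
Proof.
move=> xR.
pose A := [set y | if y is Some d then (i, d) \notin R else true].
have [|y yA ymin] := @before_best _ (P i) A None; first by rewrite inE.
have xA : x \in A by rewrite inE; case: x xR => // d; apply.
have ymin' d : (i, d) \notin R -> weakly_before (P i) y (Some d).
  by move=> dR; apply: ymin; rewrite inE.
rewrite /application; case: pickP => [c /and3P[_ c0 /forallP cbest]|none].
  case: x xR xA => [d /(_ d erefl) dR _|_ _]; last exact: before_weakly.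
  exact: implyP (cbest d) dR.
(* If the best option [y] were a school, it would pass the test of [pick]. *)
suff -> : None = y by apply: ymin.
case: y yA ymin ymin' => // c; rewrite inE => cR ymin ymin'.
have c0 : before (P i) (Some c) None.
  by have := ymin None; rewrite inE => /(_ isT)/predU1P[].
case/idP: (none c); rewrite cR c0 /=.
by apply/forallP => d; apply/implyP/ymin'.
Qed.

(** Rejections only accumulate, so a student whom [c] keeps finds nothing better than [c] available
    in the next round. *)
Lemma applicants_round R j c :
    j \in applicants P R c -> (j, c) \notin DA_round q P s R ->
  j \in applicants P (DA_round q P s R) c.
Proof.
rewrite !inE /= => /eqP jc jcR; apply/eqP.
have [_ c0] := application_Some jc.
have cbest d : (j, d) \notin DA_round q P s R ->
    weakly_before (P j) (Some c) (Some d).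
  move=> dR; rewrite -jc; apply: application_best => _ [<-].
  by apply: contra dR; rewrite inE => ->.
have : weakly_before (P j) (application P (DA_round q P s R) j) (Some c).
  by apply: application_best => _ [<-]; rewrite !inE.
case e: application => [d|]; last first.
  by rewrite weakly_beforeNgt c0.
case/predU1P=> // dc; have [/cbest] := application_Some e.
by rewrite weakly_beforeNgt dc.
Qed.

(** A school's pool only improves: among the applicants above [i], at least [q c] are kept by
    [card_above_unrejected], and these apply to [c] again. *)
Lemma rejected_outranked k i c :
    (i, c) \in iter k (DA_round q P s) set0 ->
  q c <= #|[set j in applicants P (iter k (DA_round q P s) set0) c
             | before (s c) j i]|.
Proof.
elim: k i c => [|k IHk] i c; first by rewrite inE.
rewrite iterS; move: IHk; set R := iter k _ _ => IHk icR.
have {icR} le_q : q c <= #|[set j in applicants P R c | before (s c) j i]|.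
  by move: icR; rewrite in_setU => /orP[/IHk//|]; rewrite inE => /andP[].
apply: leq_trans (card_above_unrejected le_q) _.
apply/subset_leq_card/subsetP => j.
rewrite inE => /and3P[jA ji lt_q]; rewrite inE ji andbT.
apply: applicants_round => //; rewrite in_setU negb_or.
rewrite inE /= jA /= -ltnNge lt_q andbT.
by move: jA; rewrite inE => /eqP/application_Some[].
Qed.

(** Induction on rounds: no applicant [j] of [c] has yet been rejected by [mu j], so she weakly
    prefers [c] to [mu j]. When [c] rejects [i], at least [q c] applicants outrank [i]; if [mu]
    placed [i] at [c], one of them would be placed elsewhere and block [mu]. *)
Lemma stable_not_rejected mu k i c :
    stable P s mu -> (i, c) \in iter k (DA_round q P s) set0 ->
  mu i != Some c.
Proof.
case=> ir nw nb; elim: k i c => [|k IHk] i c; first by rewrite inE.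
rewrite iterS; move: IHk; set R := iter k _ _ => IHk.
rewrite in_setU => /orP[/IHk//|]; rewrite inE /= => /andP[iA le_q].
apply/eqP => mui.
have iM : i \in assigned mu c by rewrite inE mui.
have [sub|] := boolP
  ([set j in applicants P R c | before (s c) j i] \subset assigned mu c :\ i).
  have := leq_trans le_q (subset_leq_card sub).
  by have := card_assigned_le mu c; rewrite (cardsD1 i) iM => /leq_trans h/h;
    rewrite ltnn.
case/subsetPn => j; rewrite !inE => /andP[/eqP jc ji].
have -> /= : j != i by apply: contraTneq ji => ->; rewrite beforexx.
move=> muj; apply: nb; exists j, c; split; last by exists i.
have : weakly_before (P j) (Some c) (mu j).
  rewrite -jc; apply: application_best => d muj'.
  by apply/negP => /IHk; rewrite muj' eqxx.
by case/predU1P=> // e; rewrite -e eqxx in muj.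
Qed.

Lemma DA_optimal mu i :
  stable P s mu -> weakly_before (P i) (DA q P s i) (mu i).
Proof.
move=> mu_st; rewrite /= ffunE; apply: application_best => d mui.
by apply/negP => /(stable_not_rejected mu_st)/eqP.
Qed.

Lemma DA_stable : stable P s (DA q P s).
Proof.
(* Whoever prefers [c] to her assignment was rejected by [c], and the final applicants of [c] are
   the students assigned to it. *)
have outranked i c : before (P i) (Some c) (DA q P s i) ->
    q c <= #|[set j in assigned (DA q P s) c | before (s c) j i]|.
  move=> ic.
  have icR : (i, c) \in DA_rejections q P s.
    apply/negPn/negP => icR.
    suff : weakly_before (P i) (DA q P s i) (Some c).
      by rewrite weakly_beforeNgt ic.
    by rewrite /= ffunE; apply: application_best => _ [<-].
  apply: leq_trans (rejected_outranked icR) _.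
  by apply/subset_leq_card/subsetP => j; rewrite !inE ffunE.
have all_above i c : before (P i) (Some c) (DA q P s i) ->
    [set j in assigned (DA q P s) c | before (s c) j i] =
      assigned (DA q P s) c.
  move=> /outranked le_q; apply/eqP; rewrite eqEcard.
  rewrite (leq_trans (card_assigned_le _ _) le_q) andbT.
  by apply/subsetP => j; rewrite inE => /andP[].
split.
- move=> i; rewrite /= ffunE; case e: application => [c|]; last by right.
  by left; have [] := application_Some e.
- move=> i c ic; apply/eqP; rewrite eqn_leq card_assigned_le.
  by rewrite -(all_above _ _ ic) outranked.
- move=> [i [c [ic [j]]]]; rewrite -(all_above _ _ ic) inE => /andP[_].
  by move/before_asym->.
Qed.

End DAProperties.

(** * Strategy-proofness of deferred acceptance *)

Lemma stable_change_pref P P' s mu :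
    stable P s mu -> individually_rational P' mu ->
    (forall i c, before (P' i) (Some c) (mu i) ->
                 before (P i) (Some c) (mu i)) ->
  stable P' s mu.
Proof.
case=> _ nw nb ir sub; split=> // [i c /sub|[i [c [/sub ic j]]]].
  exact: nw.
by apply: nb; exists i, c.
Qed.

(* The half of the rural hospitals theorem that concerns students. *)
Lemma stable_unmatched P s mu i :
  stable P s mu -> mu i = None -> DA q P s i = None.
Proof.
move=> mu_st mui; set nu := DA q P s.
have [ir nw _] := mu_st.
pose matched (m : matching I q) := [set j | m j != None].
have card_matched m : #|matched m| = \sum_c #|assigned m c|.
  under eq_bigr => c _ do rewrite -sum1_card.
  rewrite (exchange_big_dep (mem (matched m))) /=.
    rewrite -sum1_card; apply: eq_bigr => j; rewrite inE.
    case mj: (m j) => [c|//] _.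
    by rewrite (big_pred1 c) // => d; rewrite inE mj eq_sym.
  by move=> c j _; rewrite !inE => /eqP->.
(* School by school: if [nu] places some [j] at [c] and [mu] does not, then [j] prefers [c] to
   [mu j] by optimality, so [c] is full under [mu]. *)
have le_nu : #|matched nu| <= #|matched mu|.
  rewrite !card_matched; apply: leq_sum => c _.
  have [sub|] := boolP (assigned nu c \subset assigned mu c).
    exact: subset_leq_card.
  case/subsetPn => j; rewrite !inE => /eqP nuj muj.
  rewrite (nw j c) ?card_assigned_le //.
  have := DA_optimal j mu_st; rewrite -/nu nuj => /predU1P[e|//].
  by rewrite -e eqxx in muj.
(* By optimality [nu] matches everyone whom [mu] matches; if it also matched [i], it would match
   strictly more students. *)
apply/eqP; apply: contraTT le_nu => nui; rewrite -ltnNge.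
apply/proper_card/properP; split; last first.
  by exists i; rewrite !inE ?mui.
apply/subsetP => j; rewrite !inE; apply: contraNN => /eqP nuj.
have := DA_optimal j mu_st; rewrite -/nu nuj => /predU1P[<-//|jmu].
by have := individually_rational_weak j ir; rewrite weakly_beforeNgt jmu.
Qed.

Definition only Q c : preference C := keep Q (pred1 c).

Lemma before_onlyN Q c x : before (only Q c) x (Some c) = false.
Proof.
case: x => [d|]; last by rewrite before_asym // before_keepSN /= eqxx.
rewrite before_keepSS /= ?eqxx //.
by case: eqVneq => // ->; rewrite beforexx.
Qed.

(** The matching at [P] stays stable when [i] reports only the school she gets, since she then
    prefers nothing to it; optimality does the rest. *)
Lemma DA_only P s i c Q :
  DA q P s i = Some c -> DA q (replace_pref P i (only Q c)) s i = Some c.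
Proof.
move=> DAi; set P' := replace_pref _ _ _.
have DA_st : stable P' s (DA q P s).
  have [ir _ _] := DA_stable P s.
  apply: (stable_change_pref (DA_stable P s)) => [j|j d]; rewrite /P'.
    have [->|ji] := eqVneq j i; last by rewrite replace_pref_other.
    by rewrite replace_pref_same DAi before_keepSN /= eqxx; left.
  have [->|ji] := eqVneq j i; last by rewrite replace_pref_other.
  by rewrite replace_pref_same DAi before_onlyN.
have := DA_optimal i DA_st; rewrite /P' replace_pref_same DAi => /predU1P[//|].
by rewrite before_onlyN.
Qed.

Lemma DA_only_weak P s i c Q :
    DA q (replace_pref P i (only Q c)) s i = Some c ->
  weakly_before (P i) (DA q P s i) (Some c).
Proof.
rewrite weakly_beforeNgt => DAc; apply/negP => cDA.
have [irP _ _] := DA_stable P s.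
have c0 := before_weak_trans cDA (individually_rational_weak i irP).
pose A := [pred d | weakly_before (P i) (Some d) (Some c)].
have Ac : A c := weakly_beforexx _ _.
(* Truncating [P i] below [c] leaves [i] unmatched; the resulting matching is
   stable also when [i] reports only [c]. *)
pose Pt := replace_pref P i (keep (P i) A); pose mu := DA q Pt s.
have mu_st : stable Pt s mu := DA_stable Pt s.
have [ir _ _] := mu_st.
have irA d : mu i = Some d -> A d.
  move=> mui; case: (ir i); rewrite mui //.
  by rewrite /Pt replace_pref_same before_keepSN.
(* Otherwise [mu] would also be stable under [P] and give [i] a school at least as good as [c],
   against the optimality of [DA]. *)
have mui : mu i = None.
  case mui: (mu i) => [d|//]; have Ad := irA d mui.
  have st : stable P s mu.
    apply: (stable_change_pref mu_st) => [j|j e].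
      have := ir j; rewrite /Pt; have [->|ji] := eqVneq j i.
        by left; rewrite mui (weak_before_trans Ad c0).
      by rewrite replace_pref_other.
    rewrite /Pt; have [->|ji] := eqVneq j i; last by rewrite replace_pref_other.
    rewrite replace_pref_same mui before_keepSS // => ed; rewrite ed andbT.
    exact: before_weakly (before_weak_trans ed Ad).
  have := DA_optimal i st; rewrite mui weakly_beforeNgt.
  by rewrite (weak_before_trans Ad cDA).
have st : stable (replace_pref P i (only Q c)) s mu.
  apply: (stable_change_pref mu_st) => [j|j d].
    have := ir j; rewrite /Pt; have [->|ji] := eqVneq j i; first by right.
    by rewrite !replace_pref_other.
  rewrite /Pt; have [->|ji] := eqVneq j i; last by rewrite !replace_pref_other.
  by rewrite !replace_pref_same mui !before_keepSN => /eqP->.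
by have := stable_unmatched st mui; rewrite DAc.
Qed.

Definition manipulation_free (g : pref_profile I C -> matching I q) : Prop :=
  forall P i Q, weakly_before (P i) (g P i) (g (replace_pref P i Q) i).

Lemma DA_manipulation_free s : manipulation_free (fun P => DA q P s).
Proof.
move=> P i Q; case DAQ: (DA q (replace_pref P i Q) s i) => [c|].
  (* A school won by a misreport is also won by listing it alone. *)
  apply: (@DA_only_weak _ _ _ _ Q).
  by rewrite -(replace_pref_replace P i Q) DA_only.
by apply: individually_rational_weak; case: (DA_stable P s).
Qed.

(** * Narrow students and admissible matchings *)

Definition narrow Q : bool := #|[set c | before Q (Some c) None]| <= 1.

Lemma narrow_only Q c : narrow (only Q c).
Proof.
rewrite /narrow -(cards1 c); apply/subset_leq_card/subsetP => d.
by rewrite !inE before_keepSN.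
Qed.

Lemma narrow_eq Q c d : narrow Q ->
  before Q (Some c) None -> before Q (Some d) None -> c = d.
Proof. by move=> /card_le1_eqP eqQ c0 d0; apply: eqQ; rewrite inE. Qed.

Lemma narrow_rank Q c : narrow Q -> before Q (Some c) None ->
  rank Q (Some c) = 1.
Proof.
move=> nQ c0; congr _.+1; apply/eqP; rewrite cards_eq0; apply/eqP/setP => x.
rewrite !inE; apply/negP; case: x => [d|] dc.
  have cd := narrow_eq nQ c0 (before_trans dc c0).
  by rewrite cd beforexx in dc.
by rewrite (before_asym c0) in dc.
Qed.

Definition narrow_unblocked P s mu : Prop := forall i c j,
  narrow (P i) -> before (P i) (Some c) (mu i) -> mu j = Some c ->
  before (s c) i j = false.

Definition admissible P s mu : Prop :=
  [/\ individually_rational P mu, nonwasteful P mu & narrow_unblocked P s mu].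

Lemma stable_admissible P s mu : stable P s mu -> admissible P s mu.
Proof.
case=> ir nw nb; split=> // i c j _ ic muj; apply/negP => ij; apply: nb.
by exists i, c; split=> //; exists j; rewrite ?inE ?muj.
Qed.

Lemma narrow_unmatched P mu nu i c : individually_rational P mu ->
    individually_rational P nu -> narrow (P i) ->
  mu i = Some c -> nu i != mu i -> nu i = None /\ before (P i) (Some c) None.
Proof.
move=> irm irn nP mui; rewrite mui; case: (irm i); rewrite mui // => c0.
case: (irn i) => [|->//]; case: (nu i) => [d|//] d0.
by rewrite (narrow_eq nP c0 d0) eqxx.
Qed.

(** If [i] lost [c] under [nu], then [c] would be full there by non-wastefulness, so some [j] would
    hold a seat at [c] under [nu] but not under [mu]. Both are narrow and each is unmatched in one
    of the matchings; whichever has the higher priority at [c] blocks the matching that leaves her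
    out. *)
Lemma admissible_agree_Some P s mu nu i c :
    admissible P s mu -> admissible P s nu ->
    (forall j, ~~ narrow (P j) -> mu j = nu j) ->
  mu i = Some c -> nu i = Some c.
Proof.
move=> [irm nwm nbm] [irn nwn nbn] wide mui.
have narrow_neq j : nu j != mu j -> narrow (P j).
  by apply: contraNT => /wide->.
case: (eqVneq (nu i) (mu i)) => [->//|neq_i].
have [nui ci] := narrow_unmatched irm irn (narrow_neq i neq_i) mui neq_i.
have full : #|assigned nu c| = q c by apply: (nwn i); rewrite nui.
have [sub|] := boolP (assigned nu c \subset assigned mu c :\ i).
  have := subset_leq_card sub.
  have := card_assigned_le mu c.
  by rewrite full (cardsD1 i) inE mui eqxx => /leq_trans h/h; rewrite ltnn.
case/subsetPn => j; rewrite !inE => /eqP nuj.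
have ji : j != i by apply: contraTneq isT => ji; move: nuj; rewrite ji nui.
rewrite ji /= => muj.
have neq_j : mu j != nu j by rewrite nuj.
have nj : narrow (P j) by apply: narrow_neq; rewrite eq_sym.
have [muj0 cj] := narrow_unmatched irn irm nj nuj neq_j.
have := before_total (s c) ji.
rewrite (nbm j c i) ?muj0 // (nbn i c j) ?nui //.
exact: narrow_neq.
Qed.

Lemma admissible_agree P s mu nu :
    admissible P s mu -> admissible P s nu ->
    (forall j, ~~ narrow (P j) -> mu j = nu j) ->
  mu = nu.
Proof.
move=> mu_ok nu_ok wide; apply/val_inj/ffunP => i /=.
case mui: (mu i) => [c|].
  by rewrite (admissible_agree_Some mu_ok nu_ok wide mui).
case nui: (nu i) => [c|//].
have wide' j : ~~ narrow (P j) -> nu j = mu j by move/wide.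
by rewrite -(admissible_agree_Some nu_ok mu_ok wide' nui) mui.
Qed.

(** * Uniqueness of the strategy-proof admissible rule *)

Lemma manipulation_free_only (f : pref_profile I C -> matching I q) P i c :
    manipulation_free f ->
  f P i = Some c -> f (replace_pref P i (only (P i) c)) i = Some c.
Proof.
(* Here [only (P i) c] is the true preference and [P i] the misreport; nothing beats [c] under the
   former. *)
move=> f_sp fi; have := f_sp (replace_pref P i (only (P i) c)) i (P i).
rewrite replace_pref_same replace_prefK fi => /predU1P[//|].
by rewrite before_onlyN.
Qed.

(** If [f] assigns [c] to [i], both rules do so when she lists [c] alone, and that report cannot be
    profitable under [f']. *)
Lemma weakly_before_of_agree (f f' : pref_profile I C -> matching I q) P i :
    manipulation_free f -> manipulation_free f' ->
    individually_rational P (f' P) ->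
    (forall c, f (replace_pref P i (only (P i) c)) =
               f' (replace_pref P i (only (P i) c))) ->
  weakly_before (P i) (f' P i) (f P i).
Proof.
move=> f_sp f'_sp ir eq_ff'; case fi: (f P i) => [c|].
  have := f'_sp P i (only (P i) c).
  by rewrite -eq_ff' (manipulation_free_only f_sp fi).
exact: individually_rational_weak.
Qed.

Lemma manipulation_free_unique s (g h : pref_profile I C -> matching I q) :
    manipulation_free g -> manipulation_free h ->
    (forall P, admissible P s (g P)) -> (forall P, admissible P s (h P)) ->
  g =1 h.
Proof.
move=> g_sp h_sp g_ok h_ok P.
pose wide P := [set i | ~~ narrow (P i)].
have [m] := ubnP #|wide P|; elim: m P => // m IHm P le_m.
apply: admissible_agree (g_ok P) (h_ok P) _ => i wi.
have eq_gh c : g (replace_pref P i (only (P i) c)) =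
               h (replace_pref P i (only (P i) c)).
  (* Student [i] becomes narrow and nobody else changes, so fewer students are not narrow. *)
  apply: IHm; rewrite -ltnS; apply: leq_trans le_m; rewrite ltnS.
  apply/proper_card/properP; split.
    apply/subsetP => j; rewrite !inE ffunE.
    by case: eqVneq => // _; rewrite narrow_only.
  by exists i; rewrite !inE // replace_pref_same narrow_only.
have irg : individually_rational P (g P) by case: (g_ok P).
have irh : individually_rational P (h P) by case: (h_ok P).
have := weakly_before_of_agree g_sp h_sp irh eq_gh.
have := weakly_before_of_agree h_sp g_sp irg (fun c => esym (eq_gh c)).
by case/predU1P=> // gh; rewrite weakly_beforeNgt gh.
Qed.

Lemma outcome_admissible (phi : mechanism I q) P s :
  rd_stable phi -> rank_monotonic phi -> admissible P s (outcome phi P s).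
Proof.
move=> phi_rd phi_rm; have [ir nw nb] := phi_rd P s.
split=> // i c j nP ic phij; apply/negP => ij; apply: nb.
exists i, c; split=> //; exists j; first by rewrite inE phij.
(* Rank 1 is the least possible, so it is at most the rank of [c] for [j]. *)
apply: phi_rm => //; rewrite narrow_rank //.
exact: before_weak_trans ic (individually_rational_weak i ir).
Qed.

End Market.

Theorem theorem1 (I C : finType) (q : C -> nat) (phi : mechanism I q)
  (phi_sp : strategy_proof phi)
  (phi_rd : rd_stable phi)
  (phi_rm : rank_monotonic phi)
  (P : pref_profile I C) (s : prio_profile I C) :
  outcome phi P s = DA q P s.
Proof.
apply: (manipulation_free_unique (s := s) (g := fun P => outcome phi P s)
         (h := fun P => DA q P s)).
- by move=> P' i Q; apply: phi_sp.
- exact: DA_manipulation_free.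
- by move=> P'; apply: outcome_admissible.
- by move=> P'; apply/stable_admissible/DA_stable.
Qed.
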